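(* Let $n\ge2$, let $\left((p_0,v_0),(p_1,v_1)\right)\in(\mathbb{R}^n\times S^{n-1})^2$ be an admissible pair and let $\omega\in[0,1]$. 1. For every isometry $\Phi:\mathbb{R}^n\to\mathbb{R}^n$, writing $\tilde\Phi(p,v):=\left(\Phi(p),\,\Phi(v)-\Phi(0)\right)$, $$\tilde\Phi\left(B_\omega\left((p_0,v_0),(p_1,v_1)\right)\right)=B_\omega\left(\tilde\Phi(p_0,v_0),\tilde\Phi(p_1,v_1)\right).$$ 2. If $B_\omega\left((p_0,v_0),(p_1,v_1)\right)=(p_\omega,v_\omega)$, then for every $a>0$, $$B_\omega\left((a p_0,v_0),(a p_1,v_1)\right)=(a p_\omega,v_\omega).$$
   Context: $\mathbb{R}^n$ carries the Euclidean inner product $\langle\cdot,\cdot\rangle$ and norm $\|\cdot\|$; $S^{n-1}$ is the unit sphere. For $p_0\ne p_1$ put $u=\frac{p_1-p_0}{\|p_1-p_0\|}$ and $\theta_j=\arccos\langle v_j,u\rangle\in[0,\pi]$, $j=0,1$. Admissible pair: $p_0\neq p_1$, and either $v_0=v_1=u$ or every two of the vectors $v_0,v_1,u$ are linearly independent. (Then $\theta_0+\theta_1<2\pi$.) Bézier average: put $\alpha=\dfrac{\|p_1-p_0\|}{3\cos^2\left(\frac{\theta_0+\theta_1}{4}\right)}$, and let $b(t)$, $t\in[0,1]$, be the cubic Bézier curve with control points $p_0,\ p_0+\alpha v_0,\ p_1-\alpha v_1,\ p_1$, i.e. $$b(t)=(1-t)^3p_0+3t(1-t)^2(p_0+\alpha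 v_0)+3t^2(1-t)(p_1-\alpha v_1)+t^3p_1.$$ For $\omega\in[0,1]$, $B_\omega\left((p_0,v_0),(p_1,v_1)\right)=(p_\omega,v_\omega)$ with $p_\omega=b(\omega)$ and $v_\omega=\frac{b'(\omega)}{\|b'(\omega)\|}$ if $b'(\omega)\ne0$, $v_\omega=0$ if $b'(\omega)=0$. *)

(* Defs.v *)
From mathcomp Require Export all_boot all_order all_algebra.
From mathcomp Require Export all_classical all_reals all_analysis.
Export Order.TTheory GRing.Theory Num.Theory.
Export numFieldNormedType.Exports.

Set Implicit Arguments.
Unset Strict Implicit.
Unset Printing Implicit Defensive.

Local Open Scope ring_scope.

Definition dotv (R : realType) (n : nat) (x y : 'rV[R]_n) : R :=
  \sum_(i < n) x 0 i * y 0 i.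

(* The library norm `|x| on 'rV[R]_n is the sup norm, hence this definition.
   The two norms are equivalent, so the library derivative derive1 f of a curve
   f : R -> 'rV[R]_n is the usual one. *)
Definition enorm (R : realType) (n : nat) (x : 'rV[R]_n) : R :=
  Num.sqrt (dotv x x).

Definition isometry (R : realType) (n : nat) (Phi : 'rV[R]_n -> 'rV[R]_n) : Prop :=
  forall x y, enorm (Phi x - Phi y) = enorm (x - y).

Definition direction (R : realType) (n : nat) (p0 p1 : 'rV[R]_n) : 'rV[R]_n :=
  (enorm (p1 - p0))^-1 *: (p1 - p0).

(* acos x is the y in [0, pi] such that cos y = x, for -1 <= x <= 1 *)
Definition theta (R : realType) (n : nat) (p0 p1 v : 'rV[R]_n) : R :=
  acos (dotv v (direction p0 p1)).

Definition admissible (R : realType) (n : nat) (X0 X1 : 'rV[R]_n * 'rV[R]_n) : Prop :=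
  let: (p0, v0) := X0 in
  let: (p1, v1) := X1 in
  let u := direction p0 p1 in
  p0 <> p1 /\
  ((v0 = u /\ v1 = u) \/
   [/\ free [:: v0; v1], free [:: v0; u] & free [:: v1; u]]).

Definition alpha (R : realType) (n : nat) (X0 X1 : 'rV[R]_n * 'rV[R]_n) : R :=
  let: (p0, v0) := X0 in
  let: (p1, v1) := X1 in
  enorm (p1 - p0)
    / (3 * cos ((theta p0 p1 v0 + theta p0 p1 v1) / 4) ^+ 2).

(* Defined by the same formula on all of R, so that its derivative at the
   endpoints 0 and 1 is the ordinary two-sided one. *)
Definition bezier (R : realType) (n : nat) (X0 X1 : 'rV[R]_n * 'rV[R]_n) (t : R) :
    'rV[R]_n :=
  let: (p0, v0) := X0 in
  let: (p1, v1) := X1 in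
  let a := alpha X0 X1 in
  (1 - t) ^+ 3 *: p0
  + (3 * t * (1 - t) ^+ 2) *: (p0 + a *: v0)
  + (3 * t ^+ 2 * (1 - t)) *: (p1 - a *: v1)
  + t ^+ 3 *: p1.

Definition bezier_average (R : realType) (n : nat) (omega : R)
    (X0 X1 : 'rV[R]_n * 'rV[R]_n) : 'rV[R]_n * 'rV[R]_n :=
  let b := bezier X0 X1 in
  let db := derive1 b omega in
  (b omega, if db != 0 then (enorm db)^-1 *: db else 0).

Definition tilde (R : realType) (n : nat) (Phi : 'rV[R]_n -> 'rV[R]_n)
    (X : 'rV[R]_n * 'rV[R]_n) : 'rV[R]_n * 'rV[R]_n :=
  (Phi X.1, Phi X.2 - Phi 0).

(* Main.v *)
From HB Require Import structures.
Require Import Defs.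
From mathcomp Require Import ring.

Set Implicit Arguments.
Unset Strict Implicit.
Unset Printing Implicit Defensive.

(** Both parts are instances of one fact: the Bezier average is equivariant
    under every similarity [x |-> c + s *: L x] with [s > 0] and [L] a linear
    map preserving the inner product, when velocities are transported by [L].
    Isometries are the case [s = 1], because an isometry is an orthogonal map
    followed by a translation; the scaling [p |-> a *: p] is the case [L = id],
    [c = 0].

    For such a similarity the angles [theta] do not change, since the direction
    of [p1 - p0] is mapped by [L] and inner products are preserved; hence
    [alpha] is multiplied by [s], and the four control points of the cubic are
    moved by the similarity itself.  The Bernstein weights sum to 1, so the
    curve commutes with the affine map.  Its derivative is a combination of
    differences of consecutive control points, so the derivative is moved by
    [s *: L _], whose factor [s] disappears when the velocity is normalised. *)

Local Open Scope classical_set_scope.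
Local Open Scope ring_scope.

(** * The Euclidean inner product and the linearity of isometries *)

Section InnerProduct.
Variables (R : realType) (n : nat).
Implicit Types (x y z : 'rV[R]_n) (a : R).

Lemma dotvC x y : dotv x y = dotv y x.
Proof. by apply: eq_bigr => i _; rewrite mulrC. Qed.

Lemma dotvBl x y z : dotv (x - y) z = dotv x z - dotv y z.
Proof.
by rewrite /dotv -sumrB; apply: eq_bigr => i _; rewrite !mxE mulrBl.
Qed.

Lemma dotvBr x y z : dotv z (x - y) = dotv z x - dotv z y.
Proof. by rewrite dotvC dotvBl !(dotvC z). Qed.

Lemma dotvZl a x y : dotv (a *: x) y = a * dotv x y.
Proof.
by rewrite /dotv mulr_sumr; apply: eq_bigr => i _; rewrite !mxE mulrA.
Qed.

Lemma dotvZr a x y : dotv x (a *: y) = a * dotv x y.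
Proof. by rewrite dotvC dotvZl dotvC. Qed.

Lemma dotv_ge0 x : 0 <= dotv x x.
Proof. by apply: sumr_ge0 => i _; rewrite -expr2 sqr_ge0. Qed.

Lemma dotv_eq0 x : dotv x x = 0 -> x = 0.
Proof.
move=> /eqP; rewrite psumr_eq0 => [/allP x0|i _]; last by rewrite -expr2 sqr_ge0.
apply/rowP => i; rewrite mxE; apply/eqP.
by have := x0 i (mem_index_enum i); rewrite /= mulf_eq0 orbb.
Qed.

Lemma sqr_enorm x : enorm x ^+ 2 = dotv x x.
Proof. by rewrite sqr_sqrtr ?dotv_ge0. Qed.

Lemma enormZ a x : 0 <= a -> enorm (a *: x) = a * enorm x.
Proof.
move=> a0; rewrite /enorm dotvZl dotvZr mulrA -expr2 sqrtrM ?sqr_ge0//.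
by rewrite sqrtr_sqr ger0_norm.
Qed.

Lemma polarization x y :
  dotv x y = (enorm x ^+ 2 + enorm y ^+ 2 - enorm (x - y) ^+ 2) / 2.
Proof.
rewrite !sqr_enorm dotvBl !dotvBr (dotvC y x).
by field.
Qed.

(** If [z = a *: x + y], the square norm of [f z - a *: f x - f y] expands into
    inner products of values of [f], hence equals that of
    [z - a *: x - y = 0]. *)
Lemma dotv_preserving_linear (f : 'rV[R]_n -> 'rV[R]_n) :
  (forall x y, dotv (f x) (f y) = dotv x y) -> linear f.
Proof.
move=> fdot a x y; apply/eqP; rewrite -subr_eq0 opprD addrA; apply/eqP.
apply: dotv_eq0; set z := a *: x + y.
have -> : dotv (f z - a *: f x - f y) (f z - a *: f x - f y)
        = dotv (z - a *: x - y) (z - a *: x - y).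
  by rewrite !(dotvBl, dotvBr, dotvZl, dotvZr) !fdot; ring.
have -> : z - a *: x - y = 0 by rewrite -addrA -opprD subrr.
by rewrite /dotv big1 // => i _; rewrite mxE mul0r.
Qed.

(** By polarization: [f x = Phi x - Phi 0] preserves norms, and [f x - f y]
    is [Phi x - Phi y]. *)
Lemma isometry_dotv (Phi : 'rV[R]_n -> 'rV[R]_n) x y : isometry Phi ->
  dotv (Phi x - Phi 0) (Phi y - Phi 0) = dotv x y.
Proof.
move=> iso; rewrite !polarization !iso !subr0.
by rewrite opprB addrA subrK iso.
Qed.

End InnerProduct.

(** * Cubic curves given by control points *)

Section Cubic.
Variables (R : realType) (n : nat).
Implicit Types (q : 'rV[R]_n) (t : R).

Definition cubic q0 q1 q2 q3 t : 'rV[R]_n :=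
  (1 - t) ^+ 3 *: q0 + (3 * t * (1 - t) ^+ 2) *: q1
  + (3 * t ^+ 2 * (1 - t)) *: q2 + t ^+ 3 *: q3.

Lemma is_derive_scalel (f : R -> R) (df t : R) q :
  is_derive t 1 f df -> is_derive t 1 (fun s => f s *: q) (df *: q).
Proof.
move=> [fd <-].
have quotient : (fun h : R => h^-1 *: (((fun s => f s *: q) \o shift t) (h *: 1)
    - f t *: q)) = (fun h : R => (h^-1 *: ((f \o shift t) (h *: 1) - f t)) *: q).
  by apply/funext => h /=; rewrite -scalerBl scalerA.
have lim_q : (fun h : R => h^-1 *: (((fun s => f s *: q) \o shift t) (h *: 1)
    - f t *: q)) @ 0^' --> 'D_1 f t *: q.
  by rewrite quotient; apply: cvgZr_tmp; exact: fd.
by split; [apply/cvg_ex; exists ('D_1 f t *: q) | exact: cvg_lim].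
Qed.

(** The derivative is written in terms of differences of consecutive control
    points, which makes its independence of translations apparent. *)
Lemma derive1_cubic q0 q1 q2 q3 t :
  derive1 (cubic q0 q1 q2 q3) t =
  (3 * (1 - t) ^+ 2) *: (q1 - q0) + (6 * t * (1 - t)) *: (q2 - q1)
  + (3 * t ^+ 2) *: (q3 - q2).
Proof.
have id' : is_derive t (1 : R) (fun s : R => s) 1 by exact: is_derive_id.
have compl : is_derive t (1 : R) (fun s : R => 1 - s) (-1).
  have := is_deriveB (is_derive_cst (1 : R) t 1) id'.
  by rewrite sub0r.
have w0 := is_derive_scalel q0 (is_deriveX 3 compl).
have w1 := is_derive_scalel q1
  (is_deriveM (is_deriveM (is_derive_cst (3 : R) t 1) id') (is_deriveX 2 compl)).
have w2 := is_derive_scalel q2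
  (is_deriveM (is_deriveM (is_derive_cst (3 : R) t 1) (is_deriveX 2 id')) compl).
have w3 := is_derive_scalel q3 (is_deriveX 3 id').
rewrite derive1E.
rewrite (@derive_val _ _ _ _ _ _ _
  (is_deriveD (is_deriveD (is_deriveD w0 w1) w2) w3)).
by apply/rowP => i; rewrite !mxE !mulrfctE !exprfctE /GRing.scale /cst /=; ring.
Qed.

Lemma cubic_affine (L : {linear 'rV[R]_n -> 'rV[R]_n}) (c : 'rV[R]_n) (s : R)
    q0 q1 q2 q3 t :
  cubic (c + s *: L q0) (c + s *: L q1) (c + s *: L q2) (c + s *: L q3) t =
  c + s *: L (cubic q0 q1 q2 q3 t).
Proof.
rewrite /cubic !linearD !linearZ /=.
by apply/rowP => i; rewrite !mxE; ring.
Qed.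

Lemma derive1_cubic_affine (L : {linear 'rV[R]_n -> 'rV[R]_n})
    (c : 'rV[R]_n) (s : R) q0 q1 q2 q3 t :
  derive1 (cubic (c + s *: L q0) (c + s *: L q1) (c + s *: L q2)
                 (c + s *: L q3)) t =
  s *: L (derive1 (cubic q0 q1 q2 q3) t).
Proof.
rewrite !derive1_cubic !linearD !linearZ /= !linearN /=.
by apply/rowP => i; rewrite !mxE; ring.
Qed.

End Cubic.

(** * Equivariance of the Bezier average under similarities *)

(** The zero vector needs no case distinction, as [0^-1 *: 0 = 0]. *)
Lemma bezier_averageE (R : realType) (n : nat) (omega : R)
    (X0 X1 : 'rV[R]_n * 'rV[R]_n) :
  bezier_average omega X0 X1 =
  (bezier X0 X1 omega,
   (enorm (derive1 (bezier X0 X1) omega))^-1 *: derive1 (bezier X0 X1) omega).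
Proof.
by rewrite /bezier_average; case: eqP => //= ->; rewrite scaler0.
Qed.

Section Similarity.
Variables (R : realType) (n : nat).
Variables (L : {linear 'rV[R]_n -> 'rV[R]_n}) (c : 'rV[R]_n) (s : R).
Hypothesis Ldot : forall x y, dotv (L x) (L y) = dotv x y.
Hypothesis s_gt0 : 0 < s.

Let S (x : 'rV[R]_n) := c + s *: L x.

Lemma enorm_dotv_preserving x : enorm (L x) = enorm x.
Proof. by rewrite /enorm Ldot. Qed.

Lemma similarityB x y : S x - S y = s *: L (x - y).
Proof. by rewrite /S opprD addrACA subrr add0r linearB scalerBr. Qed.

Lemma enorm_similarityB x y : enorm (S x - S y) = s * enorm (x - y).
Proof. by rewrite similarityB enormZ ?ltW// enorm_dotv_preserving. Qed.

Lemma direction_similarity p0 p1 :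
  direction (S p0) (S p1) = L (direction p0 p1).
Proof.
rewrite /direction enorm_similarityB similarityB scalerA [in RHS]linearZ /=.
by rewrite invfM mulrAC mulVf ?gt_eqF// mul1r.
Qed.

Lemma theta_similarity p0 p1 v : theta (S p0) (S p1) (L v) = theta p0 p1 v.
Proof. by rewrite /theta direction_similarity Ldot. Qed.

Lemma alpha_similarity p0 v0 p1 v1 :
  alpha (S p0, L v0) (S p1, L v1) = s * alpha (p0, v0) (p1, v1).
Proof. by rewrite /alpha !theta_similarity enorm_similarityB mulrA. Qed.

(** The inner control points are obtained from the end points by adding
    multiples of [alpha], which is scaled by [s] exactly as the similarity
    scales vectors. *)
Lemma bezier_similarity p0 v0 p1 v1 :
  let a := alpha (p0, v0) (p1, v1) in
  bezier (S p0, L v0) (S p1, L v1) =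
  cubic (S p0) (S (p0 + a *: v0)) (S (p1 - a *: v1)) (S p1).
Proof.
move=> a; rewrite /bezier alpha_similarity -/a.
have SD x v : S (x + v) = S x + s *: L v by rewrite /S linearD scalerDr addrA.
by rewrite !SD linearN ![L (_ *: _)]linearZ /= scalerN !scalerA.
Qed.

Lemma bezier_average_similarity omega p0 v0 p1 v1 :
  bezier_average omega (S p0, L v0) (S p1, L v1) =
  (S (bezier_average omega (p0, v0) (p1, v1)).1,
   L (bezier_average omega (p0, v0) (p1, v1)).2).
Proof.
rewrite !bezier_averageE bezier_similarity /S cubic_affine derive1_cubic_affine.
congr (_, _); rewrite enormZ ?ltW// enorm_dotv_preserving scalerA.
by rewrite invfM mulrAC mulVf ?gt_eqF// mul1r [in RHS]linearZ.
Qed.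

End Similarity.

Theorem lemma2p9 (R : realType) (n : nat) (hn : (2 <= n)%N)
    (p0 v0 p1 v1 : 'rV[R]_n) (omega : R)
    (hv0 : enorm v0 = 1) (hv1 : enorm v1 = 1)
    (hadm : admissible (p0, v0) (p1, v1))
    (homega : 0 <= omega <= 1) :
  (forall Phi : 'rV[R]_n -> 'rV[R]_n, isometry Phi ->
     tilde Phi (bezier_average omega (p0, v0) (p1, v1)) =
     bezier_average omega (tilde Phi (p0, v0)) (tilde Phi (p1, v1)))
  /\
  (forall p v : 'rV[R]_n,
     bezier_average omega (p0, v0) (p1, v1) = (p, v) ->
     forall a : R, 0 < a ->
       bezier_average omega (a *: p0, v0) (a *: p1, v1) = (a *: p, v)).
Proof.
split=> [Phi iso|p v avg a a_gt0].
- pose f x := Phi x - Phi 0.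
  have fdot x y : dotv (f x) (f y) = dotv x y by exact: isometry_dotv.
  pose f_linear := GRing.isLinear.Build R 'rV[R]_n 'rV[R]_n _ f
    (dotv_preserving_linear fdot).
  pose L : {linear 'rV[R]_n -> 'rV[R]_n} := HB.pack f f_linear.
  have PhiE x : Phi x = Phi 0 + 1 *: L x by rewrite scale1r addrC subrK.
  rewrite /tilde /= (PhiE p0) (PhiE p1).
  rewrite (bezier_average_similarity (L := L) (Phi 0) fdot ltr01).
  by rewrite -PhiE.
- have := bezier_average_similarity (L := idfun) 0 (fun _ _ => erefl) a_gt0
    omega p0 v0 p1 v1.
  by rewrite avg !add0r.
Qed.
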